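(* Let $M$ be a closed quad mesh with gluing involution $\alpha$, let $v$ be a vertex of valence $w$, and let $e$ be a loop at $v$, that is an edge both of whose endpoints are $v$. Let $\gamma$ be the angular gap of $e$: the number of corners at $v$ strictly between the two ends of $e$, counted counterclockwise from the outgoing end. Let $x$ be a dart of $e$ and $\alpha(x)$ its partner. Cut $M$ along $e$ and insert one new unit square with darts $y_0,y_1,y_2,y_3$ ($y_s$ being its side $s$), by defining a new gluing involution $\alpha'$ by $$\alpha'(x)=y_2,\qquad \alpha'(\alpha(x))=y_0,\qquad \alpha'(y_1)=y_3,$$ and leaving $\alpha$ unchanged elsewhere. Then the result $M'$ is a closed quad mesh with (i) one more square; (ii) the same genus; (iii) the same vertices, except that $v$ is replaced by two vertices of valences $\gamma+2$ and $w-\gamma+2$; (iv) the same holonomy image: $\operatorname{im}\rho'=\operatorname{im}\rho$.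
   Context: Combinatorial model of a closed quad mesh (square-tiled oriented closed surface): it consists of unit squares $f=0,\dots,N-1$; its darts are the integers $4f+s$, $s\in\{0,1,2,3\}$, dart $4f+s$ being side $s$ of square $f$ traversed counterclockwise. The face rotation is $\sigma(4f+s)=4f+(s+1\bmod 4)$. The gluing is a fixed-point-free involution $\alpha$ on darts (the sides $x$ and $\alpha(x)$ are identified with opposite orientations, so that the result is an oriented surface); the edges are the pairs $\{x,\alpha(x)\}$. The vertices are the orbits of $\nu=\alpha\circ\sigma^{-1}$, the orbit through a dart consisting of the darts whose tail is that vertex; the valence of a vertex is the length of its orbit, i.e. the number of square corners at it. The mesh is connected. Holonomy: side $s$ has outward normal in direction $s$ (quarter turns), and crossing from square $f$ through its side $s$, glued to side $t$ of square $h$, has rotation $r=(t-s+2)\bmod 4\in\mathbb{Z}_4=\mathbb{Z}/4\mathbb{Z}$. For a mesh $M$ with vertex set $V$, $\rho\colon H_1(M\setminus V;\mathbb{Z})\to\mathbb{Z}_4$ sends a cycle of the dual graph (nodes are squares, one dual edge per edge; its cycles generate $H_1(M\setminus V)$) to the sum of the rotations it crosses. $\rho$ and $\rho'$ denote the holonomies of $M$ and $M'$. *)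

(* Defs.v *)
From mathcomp Require Import all_boot all_order all_algebra.

Set Implicit Arguments.
Unset Strict Implicit.
Unset Printing Implicit Defensive.

Import GRing.Theory.
Local Open Scope ring_scope.

(* The pair (f, s) is the dart 4f+s, i.e. side s of square f; the sides live   *)
(* in 'Z_4, so that the arithmetic on sides is modulo 4.                       *)
Notation dart N := ('I_N * 'Z_4)%type.

Definition dart_num N (d : dart N) : nat := (4 * d.1 + d.2)%N.

Definition face_rot N (d : dart N) : dart N := (d.1, d.2 + 1).
Definition face_rot_inv N (d : dart N) : dart N := (d.1, d.2 - 1).

Lemma face_rotK N : cancel (@face_rot N) (@face_rot_inv N).
Proof. by case=> f s; rewrite /face_rot /face_rot_inv /= addrK. Qed.

Lemma face_rot_invK N : cancel (@face_rot_inv N) (@face_rot N).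
Proof. by case=> f s; rewrite /face_rot /face_rot_inv /= subrK. Qed.

Definition adjacent N (alpha : dart N -> dart N) : rel 'I_N :=
  fun f h => [exists s, (alpha (f, s)).1 == h].

(* Squares are only glued along sides, so the surface is connected iff any two *)
(* squares are joined by a chain of adjacent squares.                          *)
Definition is_quad_mesh N (alpha : dart N -> dart N) : Prop :=
  [/\ (0 < N)%N,
      involutive alpha,
      forall d, alpha d <> d
    & forall f h : 'I_N, connect (adjacent alpha) f h].

Record quad_mesh := QuadMesh {
  nsquares : nat;
  glue : dart nsquares -> dart nsquares;
  _ : is_quad_mesh glue
}.

Notation mdart M := (dart (nsquares M)).

Section Mesh.

Variable M : quad_mesh.

Definition edges : {set {set mdart M}} :=
  [set [set d; glue d] | d : mdart M].

(* The darts leaving a vertex, in counterclockwise order: the corner of the    *)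
(* square of d at the tail of d lies between d and next_at d.                  *)
Definition next_at (d : mdart M) : mdart M := glue (face_rot_inv d).

Definition tail (d : mdart M) : {set mdart M} := [set d' in orbit next_at d].

Definition vertices : {set {set mdart M}} := [set tail d | d : mdart M].

Definition valence (v : {set mdart M}) : nat := #|v|.

(* The endpoints of an edge are the tails of its two darts.                    *)
Definition loop_at (v e : {set mdart M}) : Prop :=
  e \in edges /\ (forall d, d \in e -> tail d = v).

(* Angular gap of the edge of d, with d as outgoing end: the other end is the  *)
(* direction of glue d, and each step of next_at passes exactly one corner.    *)
Definition angular_gap (d : mdart M) : nat := findex next_at d (glue d).

Definition euler_char : int :=
  #|vertices|%:Z - #|edges|%:Z + (nsquares M)%:Z.

(* euler_char = 2 - 2 * genus                                                  *)
Definition genus : rat := (2 - euler_char%:~R) / 2.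

Definition rotation (d : mdart M) : 'Z_4 := (glue d).2 - d.2 + 2.

(* H_1(M \ V; Z) is the first homology of the dual graph, onto which M \ V     *)
(* retracts.  The graph has no 2-cells, so this is its group of integral       *)
(* 1-cycles: c d is the number of signed crossings through side d out of the   *)
(* square of d, so that reversing a dual edge changes the sign, and at every   *)
(* square the boundary vanishes.                                               *)
Definition dual_cycle (c : {ffun mdart M -> int}) : Prop :=
  (forall d, c (glue d) = - c d) /\
  (forall f : 'I_(nsquares M), \sum_(s : 'Z_4) c (f, s) = 0).

(* One summand per dual edge.  Which of its two darts is used is immaterial:   *)
(* on a cycle both c and rotation change sign under glue.                      *)
Definition holonomy (c : {ffun mdart M -> int}) : 'Z_4 :=
  \sum_(d : mdart M | (dart_num d < dart_num (glue d))%N) rotation d *~ c d.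

Definition holonomy_image (r : 'Z_4) : Prop :=
  exists2 c, dual_cycle c & holonomy c = r.

End Mesh.

(* Squares 0, ..., N-1 keep their numbers (lift ord_max preserves the value),  *)
(* and the new square has number N.                                            *)
Definition old_dart N (d : dart N) : dart N.+1 := (lift ord_max d.1, d.2).
Definition new_dart N (s : 'Z_4) : dart N.+1 := (ord_max, s).

Definition insert_square N (alpha : dart N -> dart N) (x : dart N)
    (d : dart N.+1) : dart N.+1 :=
  if unlift ord_max d.1 is Some f then
    if (f, d.2) == x then new_dart N 2
    else if (f, d.2) == alpha x then new_dart N 0
    else old_dart (alpha (f, d.2))
  else
    if d.2 == 0 then old_dart (alpha x)
    else if d.2 == 1 then new_dart N 3
    else if d.2 == 2 then old_dart x
    else new_dart N 1.

(* Main.v *)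
From mathcomp Require Import all_boot all_order all_algebra.
From mathcomp Require Import zify ring.
Require Import Defs.

Set Implicit Arguments.
Unset Strict Implicit.
Unset Printing Implicit Defensive.

Import GRing.Theory.

(** Let x be a dart of the loop.  Going counterclockwise around v, the darts
    leaving v are listed by one cycle of next_at,
      x, ..., (g darts up to) glue x, ..., (g' darts back to) x,
    where g and g' are the angular gaps of x and of glue x.  In the new mesh the
    only darts whose successor changes are the two just before glue x and just
    before x: instead of reaching the edge, the rotation now enters the new
    square, passes two of its corners and comes out on the other side of the
    cut, at the dart from which it started.  Hence the cycle breaks into
      x, ..., y_2, y_3    and    glue x, ..., y_0, y_1
    of lengths g + 2 and g' + 2 (lemma fcycle_cut), and all other cycles are
    untouched.  As the gaps g and g' add up to the valence of v (orbit_split),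
    this is the claim on vertices.  One vertex, two edges and one square are
    gained, so that the Euler characteristic, and with it the genus, is the
    same.

    For the holonomy, restricting a cycle c' of the new dual graph to the old
    darts gives a cycle c of the old one: flow conservation in the new square,
    together with c' y_1 = - c' y_3, says that what enters through y_2 leaves
    through y_0, so c' takes opposite values at x and glue x.  Every c is such
    a restriction, as a crossing of e can be rerouted straight through the new
    square from y_2 to y_0.  Restriction preserves holonomy, since going
    straight through opposite sides of a square is a path of the same total
    rotation, and since the crossing from y_1 to y_3 has rotation 3 - 1 + 2 = 0.
*)

(** * Cutting a cycle of a permutation in two *)

Section CutCycle.

Variables (T : finType) (f : T -> T) (z t : T).
Hypotheses (f_inj : injective f) (zt : fconnect f z t) (z_neq_t : z != t).

Lemma findex_gt0 : (0 < findex f z t)%N.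
Proof. by rewrite lt0n findex_eq0. Qed.

(** The second stretch ends at z because going once around the orbit of t has
    the same length as going around that of z. *)
Lemma orbit_split :
  orbit f z = traject f z (findex f z t) ++ traject f t (findex f t z).
Proof.
have lt_g := findex_max zt.
have it_g := iter_findex zt.
set g := findex f z t in lt_g it_g *.
have ord_t : order f t = order f z.
  by apply: eq_card => u; rewrite !inE (same_connect (fconnect_sym f_inj) zt).
have -> : findex f t z = (order f z - g)%N.
  rewrite -[X in findex _ _ X](iter_order f_inj) -{1}(subnK (ltnW lt_g)) iterD it_g.
  by rewrite findex_iter // ord_t; have := findex_gt0; rewrite -/g; lia.
by rewrite /orbit -{1}(subnKC (ltnW lt_g)) trajectD it_g.
Qed.

(** The situation after inserting the square: f' follows f along the copy of T,
    except that the step into t is diverted through a and b back to z. *)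
Variables (T' : finType) (h : T -> T') (f' : T' -> T') (a b : T').
Hypotheses (f'_cut : forall d, f d = t -> f' (h d) = a)
  (f'_old : forall d, f d != t -> f d != z -> f' (h d) = h (f d))
  (f'_a : f' a = b) (f'_b : f' b = h z).

Lemma fcycle_cut :
  fcycle f' (map h (traject f z (findex f z t)) ++ [:: a; b]).
Proof.
have lt_g := findex_max zt.
have it_g := iter_findex zt.
have def_g := prednK findex_gt0.
set k := (findex f z t).-1 in def_g; rewrite -def_g in lt_g it_g *.
have f_iter j : (j <= k)%N -> f (iter j f z) != z.
  move=> le_jk; apply/eqP; rewrite -iterS => fj_z.
  by have := @findex_iter _ f z j.+1; rewrite fj_z findex0; lia.
have f_iter_t j : (j < k)%N -> f (iter j f z) != t.
  move=> lt_jk; apply/eqP; rewrite -iterS => fj_t.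
  by have := @findex_iter _ f z j.+1; rewrite fj_t; lia.
rewrite trajectS /= rcons_cat cat_path last_map last_traject /=.
rewrite (f'_cut it_g) f'_a f'_b !eqxx !andbT.
(* What remains is the path before the diversion, which does not reach t and
   does not come back to z. *)
rewrite path_map; elim: k f_iter_t f_iter {lt_g it_g def_g} => [//|k IHk] ft fz.
rewrite trajectSr rcons_path last_traject /=.
rewrite IHk => [|j lt_jk|j le_jk]; [|by apply: ft; lia|by apply: fz; lia].
by rewrite -iterSr iterS f'_old ?ft ?fz ?leqnSn /=.
Qed.

End CutCycle.

Lemma fcycle_map (T T' : finType) (f : T -> T) (h : T -> T') (f' : T' -> T') p :
  {in p, forall d, f' (h d) = h (f d)} -> fcycle f p -> fcycle f' (map h p).
Proof.
move=> hE; apply: (@homo_cycle_in _ _ (mem p)) => [d d' pd _ /=|]; last exact/allP.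
by move/eqP <-; rewrite hE ?eqxx.
Qed.

(** The pairs {d, f d} partition T into blocks of size 2. *)
Lemma card_pairs (T : finType) (f : T -> T) :
    involutive f -> (forall d, f d != d) ->
  #|T| = (#|[set [set d; f d] | d : T]| * 2)%N.
Proof.
move=> fK fN; rewrite -cardsT; apply: card_uniform_partition.
  by move=> _ /imsetP[d _ ->]; rewrite cards2 eq_sym fN.
apply/and3P; split.
- apply/eqP/setP => d; rewrite inE; apply/bigcupP.
  exists [set d; f d]; last by rewrite !inE eqxx.
  by apply/imsetP; exists d.
- apply/trivIsetP => _ _ /imsetP[d _ ->] /imsetP[d' _ ->]; apply: contraNT.
  rewrite -setI_eq0 => /set0Pn[u]; rewrite !inE => /andP[].
  case/orP=> /eqP-> /orP[] /eqP dd'; apply/eqP.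
  - by rewrite dd'.
  - by rewrite dd' fK setUC.
  - by rewrite -dd' fK setUC.
  - by rewrite (can_inj fK dd').
- by apply/negP => /imsetP[d _ /setP/(_ d)]; rewrite !inE eqxx.
Qed.

(** * The gluing of the enlarged surface *)

Section InsertSquare.

Local Open Scope ring_scope.

Variables (N : nat) (alpha : dart N -> dart N) (x : dart N).
Local Notation alpha' := (insert_square alpha x).
Local Notation new := (new_dart N).

Lemma Z4_case (P : 'Z_4 -> Prop) : P 0 -> P 1 -> P 2 -> P 3 -> forall s, P s.
Proof.
move=> P0 P1 P2 P3 [[|[|[|[|//]]]] lt_s4];
  [move: P0|move: P1|move: P2|move: P3]; congr (P _); exact: val_inj.
Qed.

Lemma dart_case (P : dart N.+1 -> Prop) :
  (forall d, P (old_dart d)) -> (forall s, P (new s)) -> forall d, P d.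
Proof.
move=> Pold Pnew [f s]; case: (unliftP ord_max f) => [g|] ->; last exact: Pnew.
exact: (Pold (g, s)).
Qed.

Lemma old_dart_inj : injective (@old_dart N).
Proof.
move=> [f s] [g t] fs_gt.
by have [/= /lift_inj -> ->] := (congr1 fst fs_gt, congr1 snd fs_gt).
Qed.

Lemma new_neq_old s d : (new s == old_dart d) = false.
Proof. by apply/eqP => /(congr1 fst)/eqP; rewrite (negPf (neq_lift _ _)). Qed.

Lemma old_neq_new s d : (old_dart d == new s) = false.
Proof. by rewrite eq_sym new_neq_old. Qed.

Lemma insert_square_old d :
  alpha' (old_dart d) =
  if d == x then new 2 else if d == alpha x then new 0 else old_dart (alpha d).
Proof. by case: d => f s; rewrite /insert_square /= liftK. Qed.

Lemma insert_square_new s :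
  alpha' (new s) =
  if s == 0 then old_dart (alpha x) else if s == 1 then new 3
  else if s == 2 then old_dart x else new 1.
Proof. by rewrite /insert_square /= unlift_none. Qed.

Hypotheses (alphaK : involutive alpha) (alphaN : forall d, alpha d != d).

Lemma insert_squareK : involutive alpha'.
Proof.
have xN : (alpha x == x) = false by exact: negbTE.
elim/dart_case => [d|].
  rewrite insert_square_old; have [->|xd] := eqVneq d x.
    by rewrite insert_square_new.
  have [->|axd] := eqVneq d (alpha x); first by rewrite insert_square_new.
  rewrite insert_square_old (can2_eq alphaK alphaK) (negPf axd).
  by rewrite (inj_eq (can_inj alphaK)) (negPf xd) alphaK.
apply: Z4_case; rewrite insert_square_new /=;
  by rewrite ?insert_square_old ?insert_square_new ?xN ?eqxx.
Qed.

Lemma insert_square_fixfree d : alpha' d != d.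
Proof.
elim/dart_case: d => [d|].
  rewrite insert_square_old; case: ifP => _; first by rewrite new_neq_old.
  case: ifP => _; first by rewrite new_neq_old.
  by rewrite (inj_eq old_dart_inj).
by apply: Z4_case; rewrite insert_square_new /= ?old_neq_new // xpair_eqE andbF.
Qed.

Lemma adjacentI K (beta : dart K -> dart K) d : adjacent beta d.1 (beta d).1.
Proof. by case: d => g s; apply/existsP; exists s. Qed.

(** Squares that were glued along the cut edge are both glued to the new one. *)
Lemma insert_square_connect d :
  connect (adjacent alpha') (old_dart d).1 (old_dart (alpha d)).1.
Proof.
have adj_d := adjacentI alpha' (old_dart d); rewrite insert_square_old in adj_d.
have [d_x|d_x] := eqVneq d x.
  rewrite d_x eqxx in adj_d *.
  apply: connect_trans (connect1 adj_d) _; apply: connect1.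
  by have := adjacentI alpha' (new 0); rewrite insert_square_new.
rewrite (negPf d_x) in adj_d.
have [d_ax|d_ax] := eqVneq d (alpha x).
  rewrite d_ax eqxx in adj_d *.
  apply: connect_trans (connect1 adj_d) _; apply: connect1.
  by have := adjacentI alpha' (new 2); rewrite insert_square_new alphaK.
by rewrite (negPf d_ax) in adj_d; apply: connect1.
Qed.

End InsertSquare.

Lemma insert_square_mesh N (alpha : dart N -> dart N) x :
  is_quad_mesh alpha -> is_quad_mesh (insert_square alpha x).
Proof.
case=> _ alphaK alphaP alpha_conn.
have alphaN d : alpha d != d by apply/eqP/alphaP.
set alpha' := insert_square alpha x.
split=> // [|d|]; first exact: insert_squareK.
  exact/eqP/insert_square_fixfree.
have old_old f h : connect (adjacent alpha') (lift ord_max f) (lift ord_max h).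
  have /connectP[p] := alpha_conn f h.
  elim: p f => [|g p IHp] f /=; first by move=> _ ->.
  case/andP=> /existsP[s /eqP <-] /IHp{}IHp /IHp; apply: connect_trans.
  exact: (insert_square_connect x alphaK (f, s)).
have old_new : connect (adjacent alpha') (lift ord_max x.1) ord_max.
  have /connect1 := adjacentI alpha' (old_dart x).
  by rewrite /alpha' insert_square_old eqxx.
have new_old : connect (adjacent alpha') ord_max (lift ord_max x.1).
  have /connect1 := adjacentI alpha' (new_dart N 2%R).
  by rewrite /alpha' insert_square_new.
move=> f h.
apply: (@connect_trans _ _ (lift ord_max x.1)).
  by case: (unliftP ord_max f) => [g|] ->.
by case: (unliftP ord_max h) => [g|] ->.
Qed.

(** * Meshes: edges, vertices and holonomy *)

Lemma glue_mesh M : is_quad_mesh (@glue M).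
Proof. by case: M. Qed.

Lemma glueK M : involutive (@glue M).
Proof. by case: (glue_mesh M). Qed.

Lemma glue_fixfree M (d : mdart M) : glue d != d.
Proof. by case: (glue_mesh M) => _ _ /(_ d)/eqP. Qed.

Lemma neq_glue M (d : mdart M) : d != glue d.
Proof. by rewrite eq_sym glue_fixfree. Qed.

Lemma next_at_inj M : injective (@next_at M).
Proof.
by move=> d d' /(can_inj (@glueK M))/(can_inj (@face_rot_invK _)).
Qed.

Lemma mem_tail M (d d' : mdart M) : (d' \in tail d) = fconnect (@next_at _) d d'.
Proof. by rewrite inE fconnect_orbit. Qed.

Lemma tail_fcycle M (p : seq (mdart M)) d :
  fcycle (@next_at _) p -> d \in p -> tail d = [set d' in p].
Proof.
move=> p_cycle pd; apply/setP => d'.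
by rewrite mem_tail inE (fconnect_cycle p_cycle).
Qed.

Lemma card_edges M : (#|edges M| * 2 = nsquares M * 4)%N.
Proof.
by rewrite -(card_pairs (@glueK M) (@glue_fixfree M)) card_prod !card_ord.
Qed.

Lemma dart_num_inj N : injective (@dart_num N).
Proof.
move=> [f s] [g t]; rewrite /dart_num /= => fs_gt.
have lt_s : (s < 4)%N := ltn_ord s.
have lt_t : (t < 4)%N := ltn_ord t.
by congr (_, _); apply: val_inj => /=; lia.
Qed.

Section Holonomy.

Local Open Scope ring_scope.

Variables (M : quad_mesh) (c : {ffun mdart M -> int}) (x : mdart M).
Hypothesis c_glue : forall d, c (glue d) = - c d.

Lemma rotation_glue (d : mdart M) : rotation (glue d) = - rotation d.
Proof.
rewrite /rotation glueK; apply/eqP; rewrite -subr_eq0.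
have -> : d.2 - (glue d).2 + 2 - - ((glue d).2 - d.2 + 2) = 2 + 2 :> 'Z_4 by ring.
by [].
Qed.

(** Either dart of an edge may stand for it: c and the rotation both change sign
    under glue, the rotation because 2 + 2 = 0 in Z_4. *)
Lemma holonomyD1 :
  holonomy c = rotation x *~ c x +
    \sum_(d | [&& (dart_num d < dart_num (glue d))%N, d != x & d != glue x])
       rotation d *~ c d.
Proof.
have crossing_glue : rotation (glue x) *~ c (glue x) = rotation x *~ c x.
  by rewrite rotation_glue c_glue mulrNz mulNrz opprK.
rewrite /holonomy; have [lt_x|gt_x|/dart_num_inj x_fix] :=
  ltngtP (dart_num x) (dart_num (glue x)).
- rewrite (bigD1 x) //=; congr (_ + _); apply: eq_bigl => d.
  have [->|_] := eqVneq d (glue x); last by rewrite andbT.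
  by rewrite glueK ltnNge ltnW.
- rewrite (bigD1 (glue x)) ?glueK //= crossing_glue; congr (_ + _).
  apply: eq_bigl => d; have [->|_] := eqVneq d x; last by [].
  by rewrite ltnNge ltnW.
- by have := glue_fixfree x; rewrite -x_fix eqxx.
Qed.

End Holonomy.

Section Sums.

Local Open Scope ring_scope.

Lemma sum_Z4 (V : zmodType) (F : 'Z_4 -> V) : \sum_s F s = F 0 + F 1 + F 2 + F 3.
Proof.
rewrite !big_ord_recl big_ord0 addr0 !addrA.
by congr (F _ + F _ + F _ + F _); apply: val_inj.
Qed.

Lemma sum_dart N (V : zmodType) (P : pred (dart N.+1)) (F : dart N.+1 -> V) :
  \sum_(d | P d) F d =
  \sum_(d | P (old_dart d)) F (old_dart d) +
  \sum_(s | P (new_dart N s)) F (new_dart N s).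
Proof.
have sum_squares K (G : dart K -> V) : \sum_d G d = \sum_f \sum_s G (f, s).
  by rewrite pair_bigA; apply: eq_bigr => -[].
rewrite big_mkcond [X in _ = X + _]big_mkcond [X in _ = _ + X]big_mkcond /=.
by rewrite !sum_squares (bigD1_ord ord_max) //= addrC.
Qed.

End Sums.

(** * The mesh with the square inserted *)

Section Enlarged.

Local Open Scope ring_scope.

Variables (M : quad_mesh) (x : mdart M).
Local Notation N := (nsquares M).
Local Notation new := (new_dart N).

Definition enlarged : quad_mesh := QuadMesh (insert_square_mesh x (glue_mesh M)).
Local Notation M' := enlarged.

Lemma glue_old (d : mdart M) : @glue M' (old_dart d) =
  if d == x then new 2 else if d == glue x then new 0 else old_dart (glue d).
Proof. exact: insert_square_old. Qed.

Lemma glue_new s : @glue M' (new s) =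
  if s == 0 then old_dart (glue x) else if s == 1 then new 3
  else if s == 2 then old_dart x else new 1.
Proof. exact: insert_square_new. Qed.

Lemma next_at_old (d : mdart M) : next_at (old_dart d : mdart M') =
  if next_at d == glue x then new 2
  else if next_at d == x then new 0 else old_dart (next_at d).
Proof.
rewrite /next_at (_ : face_rot_inv (old_dart d) = old_dart (face_rot_inv d)) //.
rewrite glue_old (inj_eq (can_inj (@glueK M))).
by rewrite (can2_eq (@glueK M) (@glueK M)).
Qed.

Lemma next_at_new s : next_at (new s : mdart M') = @glue M' (new (s - 1)).
Proof. by []. Qed.

(** ** Its holonomy *)

Definition restrict (c' : {ffun mdart M' -> int}) : {ffun mdart M -> int} :=
  [ffun d => c' (old_dart d)].

(** The flow through y_1 returns through y_3, so conservation in the new square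
    leaves only what crosses from y_2 to y_0. *)
Lemma dual_cycle_new (c' : {ffun mdart M' -> int}) : dual_cycle c' ->
  c' (old_dart (glue x)) = - c' (old_dart x).
Proof.
case=> c'_glue /(_ ord_max); rewrite sum_Z4.
rewrite -!/(new _).
have := c'_glue (new 0); have := c'_glue (new 1); have := c'_glue (new 2).
by rewrite !glue_new /= => -> -> ->; lia.
Qed.

Lemma restrict_dual_cycle (c' : {ffun mdart M' -> int}) :
  dual_cycle c' -> dual_cycle (restrict c').
Proof.
move=> c'_cycle; have c'_x := dual_cycle_new c'_cycle.
case: c'_cycle => c'_glue c'_bd.
split=> [d|f]; last first.
  rewrite -[RHS](c'_bd (lift ord_max f)).
  by apply: eq_bigr => s _; rewrite ffunE.
rewrite !ffunE; have [->|d_x] := eqVneq d x; first exact: c'_x.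
have [->|d_gx] := eqVneq d (glue x); first by rewrite glueK c'_x opprK.
by have := c'_glue (old_dart d); rewrite glue_old (negPf d_x) (negPf d_gx).
Qed.

(** A crossing of the cut edge goes straight through the new square. *)
Definition extend (c : {ffun mdart M -> int}) : {ffun mdart M' -> int} :=
  [ffun d : dart N.+1 => if unlift ord_max d.1 is Some f then c (f, d.2)
   else if d.2 == 0 then c x else if d.2 == 2 then - c x else 0].

Lemma extend_old c d : extend c (old_dart d) = c d.
Proof. by case: d => f s; rewrite ffunE /= liftK. Qed.

Lemma extend_new c s :
  extend c (new s) = if s == 0 then c x else if s == 2 then - c x else 0.
Proof. by rewrite ffunE /= unlift_none. Qed.

Lemma extendK : cancel extend restrict.
Proof. by move=> c; apply/ffunP => d; rewrite ffunE extend_old. Qed.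

Lemma extend_dual_cycle c : dual_cycle c -> dual_cycle (extend c).
Proof.
case=> c_glue c_bd; split=> [|f].
  elim/dart_case => [d|].
    rewrite glue_old extend_old; have [->|d_x] := eqVneq d x.
      exact: extend_new.
    have [->|d_gx] := eqVneq d (glue x); last by rewrite extend_old c_glue.
    by rewrite extend_new c_glue opprK.
  by apply: Z4_case; rewrite glue_new /= ?extend_old !extend_new /= ?c_glue
    ?opprK ?oppr0.
case: (unliftP ord_max f) => [h|] ->.
  rewrite -[RHS](c_bd h).
  by apply: eq_bigr => s _; rewrite -(extend_old c (h, s)).
by rewrite sum_Z4 -!/(new _) !extend_new /= !addr0 subrr.
Qed.

(** Old darts have smaller numbers than new ones, so the edges {x, y_2} and
    {glue x, y_0} are counted at x and at glue x.  Their two rotations replace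
    the one of the cut edge, and the edge {y_1, y_3} has rotation 0. *)
Lemma holonomy_restrict (c' : {ffun mdart M' -> int}) :
  dual_cycle c' -> holonomy c' = holonomy (restrict c').
Proof.
move=> c'_cycle; have c'_x := dual_cycle_new c'_cycle.
have [c_glue _] := restrict_dual_cycle c'_cycle.
have num_old (d : mdart M) : dart_num (old_dart d) = dart_num d.
  by rewrite /dart_num [nat_of_ord (old_dart d).1]lift_max.
have num_new (d : mdart M) s : (dart_num (old_dart d) < dart_num (new s))%N.
  have lt_s : (d.2 < 4)%N := ltn_ord d.2.
  by have := ltn_ord d.1; rewrite num_old /dart_num /=; lia.
rewrite (holonomyD1 x c_glue) /holonomy sum_dart.
rewrite [X in _ + X]big1 ?addr0; last first.
  apply: Z4_case; rewrite glue_new /= ?ltnNge ?(ltnW (num_new _ _)) // => _;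
    by rewrite /rotation glue_new (_ : _ + 2 = 0) ?mul0rz //; apply: val_inj.
have new_rotations (a b : 'Z_4) : 2 - a + 2 - (0 - b + 2) = b - a + 2 by ring.
rewrite (bigD1 x) ?glue_old ?eqxx ?num_new //.
rewrite (bigD1 (glue x)) ?glue_old ?eqxx ?(negPf (glue_fixfree x)) ?num_new
  //=.
rewrite addrA; congr (_ + _).
  rewrite /rotation !glue_old eqxx (negPf (glue_fixfree x)) eqxx c'_x !ffunE /=.
  by rewrite mulrNz -mulNrz -mulrzDl new_rotations.
apply: eq_big => [d|d /andP[/andP[_ d_x] d_gx]].
  rewrite insert_square_old.
  have [->|d_x] := eqVneq d x; first by rewrite !andbF.
  have [->|d_gx] := eqVneq d (glue x); first by rewrite !andbF.
  by rewrite !num_old !andbT.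
by rewrite /rotation glue_old (negPf d_x) (negPf d_gx) ffunE.
Qed.

Lemma holonomy_image_enlarged r : holonomy_image M' r <-> holonomy_image M r.
Proof.
split=> -[c c_cycle <-].
  by exists (restrict c); [exact: restrict_dual_cycle|rewrite holonomy_restrict].
exists (extend c); first exact: extend_dual_cycle.
by rewrite holonomy_restrict ?extendK //; apply: extend_dual_cycle.
Qed.

(** ** Its vertices *)

Hypothesis x_loop : fconnect (@next_at M) x (glue x).

Local Notation nu := (@next_at M).
Local Notation gap := (findex nu x (glue x)).
Local Notation gap' := (findex nu (glue x) x).
(* The two cycles into which the rotation around the vertex of x breaks. *)
Local Notation p1 :=
  (map (@old_dart N) (traject nu x gap) ++ [:: new 2; new 3] : seq (mdart M')).
Local Notation p2 :=
  (map (@old_dart N) (traject nu (glue x) gap') ++ [:: new 0; new 1]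
   : seq (mdart M')).

Lemma orbit_x :
  orbit nu x = traject nu x gap ++ traject nu (glue x) gap'.
Proof. exact: orbit_split (@next_at_inj M) x_loop (neq_glue x). Qed.

Lemma p1_cycle : fcycle (@next_at M') p1.
Proof.
refine (fcycle_cut x_loop (neq_glue x) _ _ _ _) => [d|d d_gx d_x||].
- by rewrite next_at_old => ->; rewrite eqxx.
- by rewrite next_at_old (negPf d_gx) (negPf d_x).
- by rewrite next_at_new glue_new.
- by rewrite next_at_new glue_new.
Qed.

Lemma p2_cycle : fcycle (@next_at M') p2.
Proof.
have glue_x_loop : fconnect nu (glue x) x.
  by rewrite fconnect_sym //; apply: next_at_inj.
refine (fcycle_cut glue_x_loop (glue_fixfree x) _ _ _ _) => [d|d d_x d_gx||].
- by rewrite next_at_old => ->; rewrite (negPf (neq_glue x)) eqxx.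
- by rewrite next_at_old (negPf d_gx) (negPf d_x).
- by rewrite next_at_new glue_new.
- by rewrite next_at_new glue_new.
Qed.

Lemma valence_new s (r : seq (mdart M)) a b :
    uniq r -> a != b ->
    fcycle (@next_at M') (map (@old_dart N) r ++ [:: new a; new b]) ->
    s \in [:: a; b] -> valence (tail (new s : mdart M')) = (size r + 2)%N.
Proof.
move=> r_uniq a_neq_b p_cycle sab; rewrite (tail_fcycle p_cycle); last first.
  rewrite mem_cat orbC; move: sab; rewrite !inE.
  by case/orP=> /eqP->; rewrite eqxx ?orbT.
rewrite /valence cardsE.
have /card_uniqP -> : uniq (map (@old_dart N) r ++ [:: new a; new b]).
  rewrite cat_uniq map_inj_uniq ?r_uniq /=; last exact: old_dart_inj.
  rewrite !inE xpair_eqE eqxx a_neq_b !andbT !orbF negb_or.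
  by apply/andP; split; apply/mapP => -[d _ /eqP]; rewrite new_neq_old.
by rewrite size_cat size_map.
Qed.

Lemma trajects_uniq :
  uniq (traject nu x gap) /\ uniq (traject nu (glue x) gap').
Proof.
by have := orbit_uniq nu x; rewrite orbit_x cat_uniq => /and3P[].
Qed.

Lemma valence_new2 : valence (tail (new 2 : mdart M')) = (gap + 2)%N.
Proof.
by rewrite (valence_new (proj1 trajects_uniq) _ p1_cycle) ?size_traject.
Qed.

Lemma valence_new0 : valence (tail (new 0 : mdart M')) = (gap' + 2)%N.
Proof.
by rewrite (valence_new (proj2 trajects_uniq) _ p2_cycle) ?size_traject.
Qed.

Lemma valence_x : valence (tail x) = (gap + gap')%N.
Proof.
rewrite /valence /tail cardsE; have /card_uniqP -> := orbit_uniq nu x.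
by rewrite orbit_x size_cat !size_traject.
Qed.

Local Notation kept :=
  ([set [set old_dart d | d in u] | u : {set mdart M} in vertices M :\ tail x]
   : {set {set mdart M'}}).

(** Rotation is diverted into the new square only at the darts preceding x and
    glue x, and both belong to the tail of x. *)
Lemma tail_old (d : mdart M) : d \notin tail x ->
  tail (old_dart d : mdart M') = [set old_dart d' | d' in tail d].
Proof.
move=> d_x; have d_cycle : fcycle (@next_at M') (map (@old_dart N) (orbit nu d)).
  apply: fcycle_map (cycle_orbit (@next_at_inj M) d) => d'.
  rewrite -fconnect_orbit => dd'; rewrite next_at_old.
  have next_d' y : y \in tail x -> next_at d' != y.
    apply: contraTneq => <-; apply: contra d_x.
    rewrite !mem_tail => x_d'; apply: connect_trans x_d' _.
    rewrite fconnect_sym; last exact: next_at_inj.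
    exact: connect_trans dd' (fconnect1 _ _).
  by rewrite !ifN // next_d' // mem_tail.
rewrite (tail_fcycle d_cycle); last by rewrite map_f // -fconnect_orbit.
apply/setP => u; rewrite inE; apply/mapP/imsetP => -[d' d'_d ->]; exists d' => //.
  by rewrite inE.
by move: d'_d; rewrite inE.
Qed.

Lemma notin_kept s : tail (new s : mdart M') \notin kept.
Proof.
apply/imsetP => -[u _ /setP/(_ (new s))]; rewrite mem_tail connect0.
by move=> /esym/imsetP[d _ /eqP]; rewrite new_neq_old.
Qed.

Lemma tail_new_neq : tail (new 2 : mdart M') != tail (new 0 : mdart M').
Proof.
apply/eqP => /setP/(_ (new 2)); rewrite mem_tail connect0.
rewrite (tail_fcycle p2_cycle) ?inE; last by rewrite mem_cat !inE eqxx orbT.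
rewrite mem_cat !inE !xpair_eqE !andbF !orbF.
by move/esym/mapP => [d _ /eqP]; rewrite new_neq_old.
Qed.

Lemma vertices_enlarged :
  vertices M' = tail (new 2 : mdart M') |: (tail (new 0 : mdart M') |: kept).
Proof.
have tail1 d : d \in p1 -> tail d = tail (new 2 : mdart M').
  move=> p1d; rewrite (tail_fcycle p1_cycle p1d); apply/esym/tail_fcycle => //.
    exact: p1_cycle.
  by rewrite mem_cat !inE eqxx orbT.
have tail2 d : d \in p2 -> tail d = tail (new 0 : mdart M').
  move=> p2d; rewrite (tail_fcycle p2_cycle p2d); apply/esym/tail_fcycle => //.
    exact: p2_cycle.
  by rewrite mem_cat !inE eqxx orbT.
apply/setP => u; apply/imsetP/idP => [[d _ ->{u}]|].
- elim/dart_case: d => [d|].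
    have [d_x|d_x] := boolP (d \in tail x).
      move: d_x; rewrite inE orbit_x mem_cat => /orP[] d_x.
        by rewrite tail1 ?inE ?eqxx // mem_cat map_f.
      by rewrite tail2 ?inE ?eqxx ?orbT // mem_cat map_f.
    rewrite !inE; apply/or3P/Or33; rewrite tail_old //.
    apply: imset_f; rewrite !inE imset_f // andbT.
    by apply: contraNneq d_x => <-; rewrite mem_tail.
  apply: Z4_case.
  - by rewrite !inE eqxx orbT.
  - by rewrite (tail2 (new 1)) ?mem_cat !inE eqxx ?orbT.
  - by rewrite !inE eqxx.
  - by rewrite (tail1 (new 3)) ?mem_cat !inE eqxx ?orbT.
- rewrite !inE => /or3P[/eqP->|/eqP->|]; [by exists (new 2)|by exists (new 0)|].
  case/imsetP=> w /setD1P[w_x /imsetP[d _ def_w]] ->.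
  rewrite {w}def_w in w_x *; exists (old_dart d) => //.
  rewrite tail_old //; apply: contra w_x; rewrite mem_tail => xd.
  apply/eqP/setP => d'; rewrite !mem_tail.
  by rewrite (same_connect (fconnect_sym (@next_at_inj M)) xd).
Qed.

Lemma genus_enlarged : genus M' = genus M.
Proof.
rewrite /genus /euler_char vertices_enlarged !cardsU1 !inE negb_or.
rewrite tail_new_neq !notin_kept /=.
rewrite card_imset; last exact: imset_inj (@old_dart_inj N).
have := cardsD1 (tail x) (vertices M); rewrite imset_f // => ->.
have -> : #|edges M'| = (#|edges M| + 2)%N.
  apply/eqP; rewrite -(eqn_pmul2r (isT : 0 < 2)%N) mulnDl !card_edges.
  by rewrite mulSn addnC.
by congr ((_ - _%:~R) / _); move: #|edges M| #|_| => E V; lia.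
Qed.

End Enlarged.

Theorem lemma4p1 (M : quad_mesh) (v e : {set mdart M})
    (hv : v \in vertices M) (he : loop_at v e)
    (* o is the outgoing end of e, x the dart along which M is cut *)
    (o : mdart M) (ho : o \in e) (x : mdart M) (hx : x \in e) :
  let w := valence v in
  let gamma := angular_gap o in
  exists hM' : is_quad_mesh (insert_square (@glue M) x),
  let M' := QuadMesh hM' in
  [/\ nsquares M' = (nsquares M).+1,
      genus M' = genus M,
      exists v1 v2 : {set mdart M'},
        let kept : {set {set mdart M'}} :=
          [set [set old_dart d | d in u] | u : {set mdart M} in vertices M :\ v]
        in
        [/\ vertices M' = v1 |: (v2 |: kept),
            v1 != v2,
            v1 \notin kept /\ v2 \notin kept,
            valence v1 = gamma + 2
          & valence v2 = w - gamma + 2]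
    & forall r : 'Z_4, holonomy_image M' r <-> holonomy_image M r].
Proof.
have [/imsetP[d _ e_d] e_tail] := he.
have e_x : e = [set x; glue x].
  move: hx; rewrite e_d !inE => /orP[]/eqP-> //.
  by rewrite glueK setUC.
have v_x : v = tail x by rewrite e_tail.
have x_loop : fconnect (@next_at M) x (glue x).
  by rewrite -mem_tail -v_x -(e_tail (glue x)) ?mem_tail // e_x !inE eqxx orbT.
move=> w gamma; exists (insert_square_mesh x (glue_mesh M)).
split=> //; [exact: genus_enlarged| |exact: holonomy_image_enlarged].
have w_gaps : w = (angular_gap x + angular_gap (glue x))%N.
  by rewrite /w v_x valence_x // /angular_gap glueK.
pose v2 := tail (new_dart (nsquares M) 2%R : mdart (enlarged x)).
pose v0 := tail (new_dart (nsquares M) 0%R : mdart (enlarged x)).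
have v2_gap : valence v2 = angular_gap x + 2 by exact: valence_new2.
have v0_gap : valence v0 = angular_gap (glue x) + 2.
  by rewrite /angular_gap glueK; exact: valence_new0.
have v2_neq : v2 != v0 by exact: tail_new_neq.
have vE := vertices_enlarged x_loop.
(* The cycle of x has length gap x + 2, so the dart that plays the role of the
   outgoing end decides which of the two new vertices comes first. *)
move: ho; rewrite e_x !inE => /orP[]/eqP o_x.
  exists v2, v0; rewrite v_x; split=> //; first by rewrite !notin_kept.
    by rewrite v2_gap /gamma o_x.
  by rewrite v0_gap w_gaps /gamma o_x addKn.
exists v0, v2; rewrite v_x; split=> //; first by rewrite setUCA.
- by rewrite eq_sym.
- by rewrite !notin_kept.
- by rewrite v0_gap /gamma o_x.
- by rewrite v2_gap w_gaps /gamma o_x addnK.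
Qed.
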